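(* Let $P \subseteq \mathbf{R}^n$ be a lattice polytope that is the union of unimodular simplices. Then \[ h\left( P \cap \mathbf{Z}^n \right) = (hP) \cap \mathbf{Z}^n \] for every positive integer $h$. Moreover, for every positive integer $h$, if $x \in (hP) \cap \mathbf{Z}^n$, then $P \cap \mathbf{Z}^n$ contains an affinely independent set $A = \{a_0, a_1, \ldots, a_n\}$ (of $n+1$ points) such that $x = \sum_{i=0}^n t_i a_i$ for some nonnegative integers $t_0, t_1, \ldots, t_n$ with $\sum_{i=0}^n t_i = h$.
   Context: A lattice polytope in $\mathbf{R}^n$ is the convex hull of a finite set of points of $\mathbf{Z}^n$. For $X \subseteq \mathbf{R}^n$ and a positive integer $h$, the $h$-fold sumset is $hX = \{x_1 + \cdots + x_h : x_i \in X \text{ for all } i = 1, \ldots, h\}$. For an affinely independent set $A = \{a_0, a_1, \ldots, a_n\}$ of $n+1$ points in $\mathbf{R}^n$, the $n$-dimensional simplex $\Delta(A)$ generated by $A$ is the convex hull of $A$. It is a lattice simplex if $A \subseteq \mathbf{Z}^n$. For a lattice simplex $\Delta(A)$, let $\Gamma(A)$ be the subgroup of $\mathbf{Z}^n$ generated by $A - A = \{a - a' : a, a' \in A\}$. The lattice simplex $\Delta(A)$ is unimodular if $\Gamma(A) = \mathbf{Z}^n$. *)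

(* Defs.v *)
From mathcomp Require Import all_boot all_order all_algebra.
From mathcomp Require Import boolp classical_sets functions cardinality reals.
From mathcomp Require Import convex.

Set Implicit Arguments.
Unset Strict Implicit.
Unset Printing Implicit Defensive.

Import Order.TTheory GRing.Theory Num.Theory.
Local Open Scope classical_set_scope.
Local Open Scope ring_scope.

Section LatticePolytopes.
Context {R : realType} {n : nat}.
Implicit Types (X P S : set 'rV[R]_n) (a : 'I_n.+1 -> 'rV[R]_n).

Definition lattice : set 'rV[R]_n := [set x | x \is a mxOver Num.int].

Definition sumset (h : nat) X : set 'rV[R]_n :=
  [set x | exists f : 'I_h -> 'rV[R]_n, (forall i, X (f i)) /\ x = \sum_i f i].

Definition hull X : set 'rV[R]_n :=
  smallest (@convex_set R 'rV[R]_n) X.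

(* The finite set V may be empty, so the empty set counts as a polytope. *)
Definition lattice_polytope P : Prop :=
  exists V : set 'rV[R]_n, [/\ finite_set V, V `<=` lattice & P = hull V].

(* In particular a is injective, so its range consists of n+1 points. *)
Definition affinely_independent a : Prop :=
  free [tuple a (lift ord0 i) - a ord0 | i < n].

(* Gamma(A), the subgroup generated by A - A. *)
Definition difference_group X : set 'rV[R]_n :=
  smallest (fun H : set 'rV[R]_n => GRing.zmod_closed (mem H))
    [set x - y | x in X & y in X].

Definition unimodular_simplex S : Prop :=
  exists a : 'I_n.+1 -> 'rV[R]_n,
    [/\ affinely_independent a, range a `<=` lattice,
        S = hull (range a) & difference_group (range a) = lattice].

End LatticePolytopes.

Arguments lattice R n : clear implicits.

(* Main.v *)
Require Import Defs.
From mathcomp Require Import all_boot all_order all_algebra.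
From mathcomp Require Import boolp classical_sets functions cardinality reals.
From mathcomp Require Import convex.
From mathcomp Require Import interval_inference.

(** A polytope is convex, so if [x] lies in [hP] then the mean [x / h] of its
    [h] summands lies in [P] ([convex_set_mean]), hence in one of the
    unimodular simplices whose union is [P].  Let [a_0, ..., a_n] be the
    vertices of that simplex.  Scaling the barycentric coordinates of [x / h]
    by [h] gives [x = \sum_i c_i a_i] with [c_i >= 0] and [\sum_i c_i = h].

    The point is that a lattice vector [x] forces the [c_i] to be integers
    ([unimodular_coordinates_int]).  Indeed [x - h a_0] is a lattice vector,
    so by unimodularity it belongs to the group generated by the differences
    of vertices, whose elements are the integer combinations [\sum_i d_i a_i]
    with [\sum_i d_i = 0] ([difference_group_range]).  Affine independence
    makes coordinates unique ([affinely_independent_eq0]), which gives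
    [c_0 = d_0 + h] and [c_i = d_i] for the other [i].

    Being also nonnegative, the [c_i] are natural numbers; this is the second
    assertion.  Repeating each vertex [a_i] exactly [c_i] times
    ([sumset_multiples]) writes [x] as a sum of [h] lattice points of [P],
    which is the nontrivial inclusion of the first assertion. *)

Set Implicit Arguments.
Unset Strict Implicit.
Unset Printing Implicit Defensive.

Import Order.TTheory GRing.Theory Num.Theory.
Local Open Scope classical_set_scope.
Local Open Scope ring_scope.

Lemma lattice_sum (R : realType) (n : nat) (I : finType) (f : I -> 'rV[R]_n) :
  (forall i, lattice R n (f i)) -> lattice R n (\sum_i f i).
Proof.
move=> f_int; rewrite /lattice /=; apply/mxOverP => i j.
by rewrite summxE; apply: rpred_sum => k _; move: (f_int k) => /mxOverP.
Qed.

Lemma hull_convex (R : realType) (n : nat) (X : set 'rV[R]_n) :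
  convex_set (hull X).
Proof.
move=> x y l; rewrite !inE => Hx Hy C [C_convex XC].
have Cx := Hx C (conj C_convex XC); have Cy := Hy C (conj C_convex XC).
by apply/set_mem/C_convex; exact/mem_set.
Qed.

Lemma convex_set_segment (R : realType) (n : nat) (C : set 'rV[R]_n)
    (l : R) (x y : 'rV[R]_n) :
  convex_set C -> 0 <= l -> l <= 1 -> C x -> C y -> C (l *: x + (1 - l) *: y).
Proof.
move=> C_convex l0 l1 Cx Cy.
by have /set_mem := C_convex _ _ (Itv01 l0 l1) (mem_set Cx) (mem_set Cy).
Qed.

Lemma convex_set_mean (R : realType) (n : nat) (C : set 'rV[R]_n) (h : nat)
    (f : 'I_h.+1 -> 'rV[R]_n) :
  convex_set C -> (forall i, C (f i)) -> C (h.+1%:R^-1 *: \sum_i f i).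
Proof.
move=> C_convex; elim: h f => [|h IH] f Cf.
  by rewrite big_ord1 invr1 scale1r.
rewrite big_ord_recr /= scalerDr addrC.
(* The mean of h + 2 points divides the segment from the last point to the
   mean of the other h + 1 points with weight 1 / (h + 2) on the last. *)
have scaleE : (h.+2%:R : R)^-1 = (1 - h.+2%:R^-1) * h.+1%:R^-1.
  have h1 : (h.+1%:R : R) != 0 by rewrite pnatr_eq0.
  have h2 : (h.+2%:R : R) != 0 by rewrite pnatr_eq0.
  rewrite -[X in X - _](divff h2) -[X in _ - X]mul1r -mulrBl.
  rewrite -[X in (X - 1) / _]natr1 addrK.
  by rewrite mulrAC divff ?mul1r.
rewrite [X in _ + X *: _]scaleE.
rewrite -scalerA; apply: convex_set_segment => //; last exact: IH.
by rewrite invf_le1 ?ltr0n// ler1n.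
Qed.

Lemma convex_combinations_convex (R : realType) (n : nat) (I : finType)
    (a : I -> 'rV[R]_n) :
  convex_set [set x : 'rV[R]_n | exists w : I -> R,
    [/\ forall i, 0 <= w i, \sum_i w i = 1 & x = \sum_i w i *: a i]].
Proof.
move=> x y l; rewrite !inE => -[u [u0 u1 ->]] [v [v0 v1 ->]].
exists (fun i => l%:num * u i + (1 - l%:num) * v i); split.
- by move=> i; rewrite addr_ge0// mulr_ge0// subr_ge0.
- by rewrite big_split /= -!mulr_sumr u1 v1 !mulr1 addrC subrK.
- rewrite /conv /= !scaler_sumr -big_split /=; apply: eq_bigr => i _.
  by rewrite !scalerA -scalerDl.
Qed.

Lemma sum_indicator (R : realType) (I : finType) (i : I) :
  \sum_j (j == i)%:R = 1 :> R.
Proof. by rewrite (bigD1 i) //= eqxx big1 ?addr0// => j /negPf ->. Qed.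

Lemma indicator_combination (R : realType) (n : nat) (I : finType)
    (a : I -> 'rV[R]_n) (i : I) :
  \sum_j (j == i)%:R *: a j = a i.
Proof.
rewrite (bigD1 i) //= eqxx scale1r big1 ?addr0// => j /negPf ->.
by rewrite scale0r.
Qed.

(** The convex combinations form a convex set containing the points, as the
    indicators are admissible weights; minimality of the hull does the rest. *)
Lemma hull_range (R : realType) (n : nat) (I : finType) (a : I -> 'rV[R]_n)
    (x : 'rV[R]_n) :
  hull (range a) x -> exists w : I -> R,
    [/\ forall i, 0 <= w i, \sum_i w i = 1 & x = \sum_i w i *: a i].
Proof.
apply: (smallest_sub (convex_combinations_convex (a := a))) => _ [i _ <-].
exists (fun j => (j == i)%:R).
by split=> [j||]; rewrite ?ler0n ?sum_indicator ?indicator_combination.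
Qed.

(** Integer weights of sum 0 are closed under subtraction, so these
    combinations form a group; it contains every difference of two points, a
    difference of two indicators being such a weight. *)
Lemma difference_group_range (R : realType) (n : nat) (I : finType)
    (a : I -> 'rV[R]_n) (x : 'rV[R]_n) :
  difference_group (range a) x -> exists d : I -> R,
    [/\ forall i, d i \is a Num.int, \sum_i d i = 0 & x = \sum_i d i *: a i].
Proof.
apply: (@smallest_sub _ (fun H => GRing.zmod_closed (mem H)) _
  [set y | exists d : I -> R,
  [/\ forall i, d i \is a Num.int, \sum_i d i = 0 & y = \sum_i d i *: a i]]).
  split.
    apply/mem_set; exists (fun=> 0); split => [i||]; first exact: rpred0.
    - by rewrite big1.
    - by rewrite big1// => i _; rewrite scale0r.
  move=> _ _ /set_mem[d [dZ d0 ->]] /set_mem[e [eZ e0 ->]].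
  apply/mem_set; exists (fun i => d i - e i); split.
  - by move=> i; rewrite rpredB.
  - by rewrite sumrB d0 e0 subr0.
  - by rewrite -sumrB; apply: eq_bigr => i _; rewrite scalerBl.
move=> _ [_ [i _ <-]] [_ [k _ <-] <-].
exists (fun j => (j == i)%:R - (j == k)%:R); split.
- by move=> j; rewrite rpredB// rpred_nat.
- by rewrite sumrB !sum_indicator subrr.
- under eq_bigr do rewrite scalerBl.
  by rewrite sumrB !indicator_combination.
Qed.

(** The usual symmetric form of affine independence, without a base point:
    since [c_0] is minus the sum of the other coefficients, the vanishing
    combination is one of the vectors [a_i - a_0]. *)
Lemma affinely_independent_eq0 (R : realType) (n : nat)
    (a : 'I_n.+1 -> 'rV[R]_n) (c : 'I_n.+1 -> R) :
  affinely_independent a -> \sum_i c i = 0 -> \sum_i c i *: a i = 0 ->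
  forall i, c i = 0.
Proof.
move=> /freeP a_free c_sum c_comb.
have c0E : c ord0 = - \sum_(i < n) c (lift ord0 i).
  by apply/eqP; rewrite -addr_eq0 -big_ord_recl c_sum.
have c_lift i : c (lift ord0 i) = 0.
  apply: (a_free (fun i => c (lift ord0 i))).
  under eq_bigr do rewrite (nth_mktuple _ 0) scalerBr.
  rewrite sumrB -scaler_suml -[X in _ - X]opprK -scaleNr -c0E opprK addrC.
  by rewrite -[RHS]c_comb big_ord_recl.
move=> i; case: (unliftP ord0 i) => [j|] -> //.
by rewrite c0E big1 ?oppr0.
Qed.

(** Subtracting [h a_0] makes the coefficients sum to 0, where unimodularity
    supplies integer coefficients and affine independence identifies them with
    the given ones, [h] being added back to the coefficient of [a_0]. *)
Lemma unimodular_coordinates_int (R : realType) (n : nat)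
    (a : 'I_n.+1 -> 'rV[R]_n) (h : nat) (c : 'I_n.+1 -> R) :
  affinely_independent a -> range a `<=` lattice R n ->
  difference_group (range a) = lattice R n ->
  \sum_i c i = h%:R -> lattice R n (\sum_i c i *: a i) ->
  forall i, c i \is a Num.int.
Proof.
move=> a_free a_lattice a_gen c_sum c_lattice.
have : difference_group (range a) (\sum_i c i *: a i - a ord0 *+ h).
  have a0_lattice : lattice R n (a ord0) by apply: a_lattice; exists ord0.
  rewrite a_gen; apply/mxOverP => i j; rewrite !mxE mulmxnE.
  by apply: rpredB; [|apply: rpredMn]; exact/mxOverP.
move=> /difference_group_range[d [dZ d_sum d_comb]].
pose e (i : 'I_n.+1) : R := h%:R * (i == ord0)%:R.
have eZ i : e i \is a Num.int by apply: rpredM; exact: rpred_nat.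
have e_sum : \sum_i e i = h%:R.
  by rewrite -mulr_sumr sum_indicator mulr1.
have e_comb : \sum_i e i *: a i = a ord0 *+ h.
  under eq_bigr do rewrite -scalerA.
  by rewrite -scaler_sumr indicator_combination scaler_nat.
move=> i; suff -> : c i = d i + e i by rewrite rpredD.
apply/eqP; rewrite -subr_eq0; apply/eqP; move: i.
apply: affinely_independent_eq0 (a_free) _ _.
  by rewrite sumrB big_split /= c_sum d_sum e_sum add0r subrr.
under eq_bigr do rewrite scalerBl scalerDl.
by rewrite sumrB big_split /= -d_comb e_comb subrK subrr.
Qed.

(** Sequences avoid building by hand an indexing of the summands by an
    ordinal type. *)
Lemma sumset_seq (R : realType) (n : nat) (X : set 'rV[R]_n)
    (s : seq 'rV[R]_n) :
  (forall y, y \in s -> X y) -> sumset (size s) X (\sum_(y <- s) y).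
Proof.
move=> Xs; exists (fun i => s`_i); split; first by move=> i; exact/Xs/mem_nth.
by rewrite (big_nth 0) big_mkord.
Qed.

Lemma sumset_multiples (R : realType) (n : nat) (X : set 'rV[R]_n)
    (I : finType) (a : I -> 'rV[R]_n) (t : I -> nat) :
  range a `<=` X -> sumset (\sum_i t i) X (\sum_i a i *+ t i).
Proof.
move=> aX; pose s := flatten [seq nseq (t i) (a i) | i <- enum I].
have -> : (\sum_i t i)%N = size s.
  rewrite size_flatten /shape -map_comp sumnE big_map big_enum /=.
  by apply: eq_bigr => i _; rewrite size_nseq.
have -> : \sum_i a i *+ t i = \sum_(y <- s) y.
  rewrite big_flatten big_map big_enum /=; apply: eq_bigr => i _.
  by rewrite big_nseq iter_addr_0.
apply: sumset_seq => y /flatten_mapP[i _ /nseqP[-> _]].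
by apply: aX; exists i.
Qed.

Theorem theorem1 (R : realType) (n : nat) (P : set 'rV[R]_n)
    (P_polytope : lattice_polytope P)
    (P_union : exists T : set (set 'rV[R]_n),
       (forall S, T S -> unimodular_simplex S) /\ P = \bigcup_(S in T) S) :
  (forall h : nat, (0 < h)%N ->
     sumset h (P `&` lattice R n) = sumset h P `&` lattice R n) /\
  (forall h : nat, (0 < h)%N ->
     forall x : 'rV[R]_n, (sumset h P `&` lattice R n) x ->
       exists a : 'I_n.+1 -> 'rV[R]_n,
         [/\ affinely_independent a,
             range a `<=` P `&` lattice R n &
             exists t : 'I_n.+1 -> nat,
               x = \sum_i a i *+ t i /\ (\sum_i t i)%N = h]).
Proof.
have decomposition h : (0 < h)%N -> forall x : 'rV[R]_n,
    (sumset h P `&` lattice R n) x -> exists a : 'I_n.+1 -> 'rV[R]_n,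
      [/\ affinely_independent a, range a `<=` P `&` lattice R n &
          exists t : 'I_n.+1 -> nat,
            x = \sum_i a i *+ t i /\ (\sum_i t i)%N = h].
  case: h => // h _ x [[f [Pf xE]] x_lattice].
  have P_convex : convex_set P.
    by have [V [_ _ ->]] := P_polytope; exact: hull_convex.
  have [T [T_unimodular PE]] := P_union.
  have : P (h.+1%:R^-1 *: x) by rewrite xE; exact: convex_set_mean.
  rewrite {1}PE => -[S TS Sx].
  have [a [a_free a_lattice SE a_gen]] := T_unimodular _ TS.
  move: Sx; rewrite SE => /hull_range[w [w_ge0 w_sum w_comb]].
  pose c i := h.+1%:R * w i.
  have c_ge0 i : 0 <= c i by rewrite mulr_ge0.
  have c_sum : \sum_i c i = h.+1%:R by rewrite -mulr_sumr w_sum mulr1.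
  have c_comb : x = \sum_i c i *: a i.
    under eq_bigr do rewrite -scalerA.
    by rewrite -scaler_sumr -w_comb scalerA divff ?scale1r// pnatr_eq0.
  have c_nat i : c i \is a Num.nat.
    rewrite natrEint c_ge0 andbT.
    apply: (unimodular_coordinates_int a_free a_lattice a_gen c_sum).
    by rewrite -c_comb.
  have cE i : c i = (Num.truncn (c i))%:R by rewrite truncnK.
  exists a; split => //.
    move=> y ay; split; last exact: a_lattice.
    by rewrite PE; exists S => //; rewrite SE; exact: sub_gen_smallest.
  exists (fun i => Num.truncn (c i)); split.
    by rewrite c_comb; apply: eq_bigr => i _; rewrite [in LHS]cE scaler_nat.
  apply/eqP; rewrite -(eqr_nat R) natr_sum -c_sum; apply/eqP.
  by apply: eq_bigr => i _.
split=> // h h_gt0; apply/seteqP; split => x.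
  move=> [f [PLf ->]]; split; last by apply: lattice_sum => i; case: (PLf i).
  by exists f; split => // i; case: (PLf i).
move=> /(decomposition h h_gt0)[a [_ aPL [t [-> <-]]]].
exact: sumset_multiples.
Qed.
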